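(* Let $h:\mathbb{C}\to\mathbb{C}$ be an affine mapping, $h(z)=az+b\bar z+e$ with $a,b,e\in\mathbb{C}$ and $|a|>|b|$, let $c\in\mathbb{C}$, and let $f(z)=h(z)^2+c$. Then there exist a neighbourhood $U=U(h,c)$ of infinity with $f(U)\subset U$ and a quasiconformal map $\psi=\psi(h,c)$ defined on $U$ such that $$h(\psi(z))^2=\psi(f(z))$$ for all $z\in U$. Further, $\psi$ is asymptotically conformal as $|z|\to\infty$.
   Context: A neighbourhood of infinity is understood as a subset of $\mathbb{C}$, i.e. an open set containing $\{|z|>R\}$ for some $R$. A quasiconformal map is an injective quasiregular map. The complex dilatation of a quasiconformal map $\psi$ is $\mu_\psi=\psi_{\bar z}/\psi_z$. A quasiconformal map $\psi$ defined near infinity is asymptotically conformal as $|z|\to\infty$ if for every $\epsilon>0$ there is a neighbourhood $V$ of infinity such that $|\mu_\psi(z)|<\epsilon$ for (almost every) $z\in V$. *)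

(* Defs.v *)
From mathcomp Require Import all_boot all_order all_algebra.
From mathcomp Require Import all_classical all_reals all_analysis.
From mathcomp Require Import complex.
Import Order.TTheory GRing.Theory Num.Theory.
Import numFieldNormedType.Exports.

Set Implicit Arguments.
Unset Strict Implicit.
Unset Printing Implicit Defensive.

Local Open Scope classical_set_scope.
Local Open Scope ring_scope.
Local Open Scope complex_scope.

(* The topology on C is that of the numeric field [R[i]], carried by its
   regular alias [R[i]^o]; [Normc.normc] is the modulus with values in R
   (whereas [`|z|] lives in [R[i]]).  Maps defined on an open set U are
   represented by total functions, of which only the values on U matter. *)

Section Plane.
Variable R : realType.
Local Notation C := R[i].
Implicit Types (f psi : C -> C) (U V : set C) (z v : C).

Definition cplx (p : R * R) : C := p.1 +i* p.2.

Local Notation area := (@lebesgue_measure R \x @lebesgue_measure R)%E.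

Definition nbhd_infty V : Prop :=
  open (V : set C^o) /\
  exists r : R, forall z, r < Normc.normc z -> V z.

Definition abs_continuous_on (a b : R) (g : R -> C) : Prop :=
  forall eps : R, 0 < eps -> exists2 delta : R, 0 < delta &
    forall s : seq (R * R),
      {in s, forall p, a <= p.1 /\ p.1 <= p.2 /\ p.2 <= b} ->
      pairwise (fun p q => (p.2 <= q.1) || (q.2 <= p.1)) s ->
      \sum_(p <- s) (p.2 - p.1) < delta ->
      \sum_(p <- s) Normc.normc (g p.2 - g p.1) < eps.

Definition closed_rect (a b c d : R) : set (R * R) := `[a, b] `*` `[c, d].

Definition ACL U f : Prop :=
  {in U, continuous (f : C^o -> C^o)} /\
  forall a b c d : R, a < b -> c < d -> cplx @` closed_rect a b c d `<=` U ->
    {ae @lebesgue_measure R, forall y, c <= y <= d ->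
       abs_continuous_on a b (fun x => f (x +i* y))} /\
    {ae @lebesgue_measure R, forall x, a <= x <= b ->
       abs_continuous_on c d (fun y => f (x +i* y))}.

(* Partial derivatives; for an ACL map they exist almost everywhere. *)
Definition partial_x f z : C :=
  derive1 (fun t : R => complex.Re (f (t +i* complex.Im z))) (complex.Re z) +i*
  derive1 (fun t : R => complex.Im (f (t +i* complex.Im z))) (complex.Re z).

Definition partial_y f z : C :=
  derive1 (fun t : R => complex.Re (f (complex.Re z +i* t))) (complex.Im z) +i*
  derive1 (fun t : R => complex.Im (f (complex.Re z +i* t))) (complex.Im z).

(* ACL^2: partial derivatives in L^2_loc(U); every compact subset of U is
   covered by finitely many closed rectangles contained in U. *)
Definition ACL2 U f : Prop :=
  ACL U f /\
  forall a b c d : R, a < b -> c < d -> cplx @` closed_rect a b c d `<=` U ->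
    (\int[area]_(p in closed_rect a b c d)
       ((Normc.normc (partial_x f (cplx p))) ^+ 2)%:E < +oo)%E /\
    (\int[area]_(p in closed_rect a b c d)
       ((Normc.normc (partial_y f (cplx p))) ^+ 2)%:E < +oo)%E.

Definition differential f z v : C :=
  (complex.Re v)%:C * partial_x f z + (complex.Im v)%:C * partial_y f z.

Definition jacobian f z : R :=
  complex.Re (partial_x f z) * complex.Im (partial_y f z) -
  complex.Im (partial_x f z) * complex.Re (partial_y f z).

(* |Df(z)|^2 <= K J_f(z) almost everywhere, with |Df(z)| the operator norm. *)
Definition quasiregular U f : Prop :=
  ACL2 U f /\
  exists2 K : R, 1 <= K &
    {ae area, forall p, U (cplx p) ->
       forall v, Normc.normc v = 1 ->
         (Normc.normc (differential f (cplx p) v)) ^+ 2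
           <= K * jacobian f (cplx p)}.

Definition quasiconformal U f : Prop :=
  quasiregular U f /\ {in U &, injective f}.

Definition d_z f z : C := (partial_x f z - (0 +i* 1) * partial_y f z) / 2%:R.

Definition d_zbar f z : C := (partial_x f z + (0 +i* 1) * partial_y f z) / 2%:R.

(* Division by zero yields 0, but the z-derivative of a quasiconformal map
   vanishes only on a null set. *)
Definition dilatation f z : C := d_zbar f z / d_z f z.

Definition asymptotically_conformal U psi : Prop :=
  forall eps : R, 0 < eps ->
    exists V, [/\ nbhd_infty V, V `<=` U &
      {ae area, forall p, V (cplx p) ->
         Normc.normc (dilatation psi (cplx p)) < eps}].

Definition affine_map (a b e : C) (z : C) : C := a * z + b * conjc z + e.

End Plane.

(* Main.v *)
Require Import Defs.
From mathcomp Require Import all_boot all_order all_algebra.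
From mathcomp Require Import all_classical all_reals all_analysis.
From mathcomp Require Import complex.
From mathcomp Require Import ring lra.
Import Order.TTheory GRing.Theory Num.Theory.
Import numFieldNormedType.Exports.
Set Implicit Arguments.
Unset Strict Implicit.
Local Open Scope classical_set_scope.
Local Open Scope ring_scope.
Local Open Scope complex_scope.

(** Write psi z = z + eta z and let L be the real-linear part of h.  The
conjugacy h (psi z) ^ 2 = psi (f z) becomes the fixed-point equation
  L (eta z) = (c + eta (f z) - (L (eta z)) ^ 2) / (2 h z),
whose right-hand side is a contraction for the sup norm over |z| > r when r is
large, because of the division by 2 h z.  It also preserves the two-point bound
|eta z - eta w| <= |z - w| / min (|z|, |w|): the factor h z + h w in f z - f w
cancels against 2 h z, while the weight improves from |z| to |f z| >= A |z|.
So the Lipschitz constant of eta tends to 0 at infinity, and psi is a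
perturbation of the identity.

Differentiability of eta comes from the same self-improvement.  Say that eta is
k-linear at z if it is within k |v| + o(|v|) of a real-linear map.  The slope
bound makes eta (2/|z|)-linear everywhere, and if eta is k-linear at f z then
it is (3 H k / l)-linear at z, where H and l are the largest and the smallest
stretching of L; as |f z| >= A |z| with A >= 12 H / l, iterating forces k to 0.
Hence the partial derivatives of psi exist everywhere, and those of eta
are O(1/|z|). *)

(** * The real-valued modulus on the complex numbers *)

Section Modulus.
Context {R : realType}.
Implicit Types x y z w : R[i].
Local Notation N := (@Normc.normc R).

Lemma normc_ge0 z : 0 <= N z.
Proof. by case: z => x y; exact: sqrtr_ge0. Qed.

Lemma normc_gt0 z : z != 0 -> 0 < N z.
Proof.
move=> z0; rewrite lt_neqAle normc_ge0 andbT eq_sym.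
by apply: contra z0 => /eqP /Normc.eq0_normc ->.
Qed.

Lemma normc_triangle x y : N (x + y) <= N x + N y.
Proof. exact: le_normcD. Qed.

Lemma normc_opp x : N (- x) = N x.
Proof. exact: normcN. Qed.

Lemma normc_distC x y : N (x - y) = N (y - x).
Proof. by rewrite -normc_opp opprB. Qed.

Lemma normc_triangleB x y : N (x - y) <= N x + N y.
Proof. by rewrite -(normc_opp y); exact: normc_triangle. Qed.

Lemma normc_sub_ge x y : N x - N y <= N (x + y).
Proof. by have := normc_triangleB (x + y) y; rewrite addrK; lra. Qed.

Lemma normc_conj z : N (conjc z) = N z.
Proof. by case: z => x y /=; rewrite sqrrN. Qed.

Lemma normc_real (t : R) : N t%:C = `|t|.
Proof. by rewrite /= expr0n addr0 sqrtr_sqr. Qed.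

Lemma normc_nat n : N n%:R = n%:R.
Proof. by have := normc_real n%:R; rewrite rmorph_nat normr_nat. Qed.

Lemma normcX z n : N (z ^+ n) = N z ^+ n.
Proof.
elim: n => [|n IH]; first by rewrite !expr0 Normc.normc1.
by rewrite !exprS Normc.normcM IH.
Qed.

Lemma normc_ge_absRe z : `|complex.Re z| <= N z.
Proof.
by case: z => x y /=; rewrite -sqrtr_sqr ler_wsqrtr // lerDl sqr_ge0.
Qed.

Lemma normc_ge_absIm z : `|complex.Im z| <= N z.
Proof.
by case: z => x y /=; rewrite -sqrtr_sqr ler_wsqrtr // lerDr sqr_ge0.
Qed.

Lemma normc_i : N 'i = 1.
Proof. by rewrite /= expr0n add0r expr1n sqrtr1. Qed.

Lemma normc_le_absD z : N z <= `|complex.Re z| + `|complex.Im z|.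
Proof.
rewrite {1}(complexE z); apply: le_trans (normc_triangle _ _) _.
by rewrite Normc.normcM normc_i mul1r !normc_real.
Qed.

Lemma ReB x y : complex.Re (x - y) = complex.Re x - complex.Re y.
Proof. by case: x y => [? ?] []. Qed.

Lemma ImB x y : complex.Im (x - y) = complex.Im x - complex.Im y.
Proof. by case: x y => [? ?] []. Qed.

End Modulus.

(** * Geometric limits and difference quotients on the real line *)

Section RealLine.
Context {R : realType}.
Implicit Types (x y k t : R) (g : R -> R).

Lemma geometric_small k (eps : R) : 0 < eps -> exists n, k * 2^-1 ^+ n <= eps.
Proof.
move=> eps0; have [n kn] : exists n : nat, k / eps < n%:R.
  exists (Num.bound `|k / eps|); apply: le_lt_trans (ler_norm _) _.
  exact: archi_boundP.
exists n; rewrite exprVn ler_pdivrMr ?exprn_gt0 //.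
rewrite mulrC -ler_pdivrMr // (le_trans (ltW kn)) //.
by rewrite -natrX ler_nat ltnW // ltn_expl.
Qed.

Lemma le_of_geometric x y k : (forall n, x <= y + k * 2^-1 ^+ n) -> x <= y.
Proof.
move=> xyk; apply/ler_addgt0Pr => eps /(geometric_small k)[n kn].
by apply: le_trans (xyk n) _; rewrite lerD2l.
Qed.

(** The sequence [u n - 2 * 2^-1 ^+ n] increases and [u n + 2 * 2^-1 ^+ n] decreases; the supremum
    of the first lies between them. *)
Lemma geometric_limit (u : nat -> R) :
  (forall n, `|u n.+1 - u n| <= 2^-1 ^+ n) ->
  exists l, forall n, `|u n - l| <= 2 * 2^-1 ^+ n.
Proof.
move=> uS; pose v n := u n - 2 * 2^-1 ^+ n.
have step n : v n <= v n.+1 /\ u n.+1 + 2 * 2^-1 ^+ n.+1 <= u n + 2 * 2^-1 ^+ n.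
  by have := uS n; rewrite /v exprS ler_norml => /andP[]; split; lra.
have vm n j : v n <= v (n + j)%N.
  elim: j => [|j IH]; first by rewrite addn0.
  by rewrite addnS (le_trans IH) //; case: (step (n + j)%N).
have um n j : u (n + j)%N + 2 * 2^-1 ^+ (n + j) <= u n + 2 * 2^-1 ^+ n.
  elim: j => [|j IH]; first by rewrite addn0.
  by rewrite addnS (le_trans _ IH) //; case: (step (n + j)%N).
have p2 n : 0 < 2^-1 ^+ n :> R by rewrite exprn_gt0.
have ub n : ubound (range v) (u n + 2 * 2^-1 ^+ n).
  move=> _ [k _ <-]; have := vm k n; have := um n k.
  by rewrite addnC /v; have := p2 (k + n)%N; lra.
have hs : has_sup (range v).
  by split; [exists (v 0%N), 0%N | exists (u 0%N + 2 * 2^-1 ^+ 0)].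
exists (sup (range v)) => n.
have h1 : sup (range v) <= u n + 2 * 2^-1 ^+ n by apply: ge_sup => //; case: hs.
have h2 : v n <= sup (range v) by apply: ub_le_sup; [case: hs | exists n].
by rewrite ler_norml; move: h1 h2; rewrite /v; lra.
Qed.

(** The slope [m] may change with [eps]: no candidate derivative is needed, since the quotients end
    up within [eps] of some [m], hence are Cauchy, and completeness gives the limit. *)
Lemma cvg_quotient_of_approx g x :
  (forall eps, 0 < eps -> exists m d : R, 0 < d /\
     forall t, `|t| < d -> `|g (t + x) - g x - m * t| <= eps * `|t|) ->
  cvg ((fun t => t^-1 *: (g (t + x) - g x)) @ 0^').
Proof.
move=> gm; apply: cauchy_cvg; apply: cauchy_exP => eps eps0.
have [|m [d [d0 gd]]] := gm (eps / 2); first lra.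
exists m; rewrite /ball /=; near=> t; rewrite /preimage /=.
have t0 : t != 0 by near: t; exact: nbhs_dnbhs_neq.
have td : `|t| < d.
  near: t; apply: nbhs_dnbhs; exists d => //= t.
  by rewrite /ball /= sub0r normrN.
have -> : m - t^-1 *: (g (t + x) - g x) = - ((g (t + x) - g x - m * t) / t).
  by rewrite /GRing.scale /=; field.
rewrite normrN normrM normfV ltr_pdivrMr ?normr_gt0 //.
apply: le_lt_trans (gd _ td) _; rewrite ltr_pM2r ?normr_gt0 //; lra.
Unshelve. all: by end_near. Qed.

(** [derive1] is a [lim], and the first hypothesis makes it a genuine limit of quotients. The last
    hypothesis, with a fixed [m], bounds these quotients, and the bound passes to the limit. *)
Lemma derive1_dist g x m k (d : R) :
  (forall eps, 0 < eps -> exists m d : R, 0 < d /\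
     forall t, `|t| < d -> `|g (t + x) - g x - m * t| <= eps * `|t|) ->
  0 < d -> (forall t, `|t| < d -> `|g (t + x) - g x - m * t| <= k * `|t|) ->
  `|derive1 g x - m| <= k.
Proof.
move=> /cvg_quotient_of_approx cg d0 gd; rewrite /derive1.
have near_bound : \forall t \near 0^',
    m - k <= t^-1 *: (g (t + x) - g x) <= m + k.
  near=> t.
  have t0 : t != 0 by near: t; exact: nbhs_dnbhs_neq.
  have td : `|t| < d.
    near: t; apply: nbhs_dnbhs; exists d => //= t.
    by rewrite /ball /= sub0r normrN.
  have : `|t^-1 *: (g (t + x) - g x) - m| <= k.
    have -> : t^-1 *: (g (t + x) - g x) - m = (g (t + x) - g x - m * t) / t.
      by rewrite /GRing.scale /=; field.
    by rewrite normrM normfV ler_pdivrMr ?normr_gt0 ?gd.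
  by rewrite ler_norml => /andP[]; lra.
have h1 : lim ((fun t => t^-1 *: (g (t + x) - g x)) @ 0^') <= m + k.
  by apply: limr_le => //; apply: filterS near_bound => t /andP[].
have h2 : m - k <= lim ((fun t => t^-1 *: (g (t + x) - g x)) @ 0^').
  by apply: limr_ge => //; apply: filterS near_bound => t /andP[].
by rewrite ler_norml; move: h1 h2; lra.
Unshelve. all: by end_near. Qed.

End RealLine.

Lemma geometric_limit_complex {R : realType} (u : nat -> R[i]) :
  (forall n, Normc.normc (u n.+1 - u n) <= 2^-1 ^+ n) ->
  exists l, forall n, Normc.normc (u n - l) <= 4 * 2^-1 ^+ n.
Proof.
move=> uS.
have [x xP] : exists x, forall n, `|complex.Re (u n) - x| <= 2 * 2^-1 ^+ n.
  by apply: geometric_limit => n; rewrite -ReB (le_trans (normc_ge_absRe _)).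
have [y yP] : exists y, forall n, `|complex.Im (u n) - y| <= 2 * 2^-1 ^+ n.
  by apply: geometric_limit => n; rewrite -ImB (le_trans (normc_ge_absIm _)).
exists (x +i* y) => n; apply: le_trans (normc_le_absD _) _.
by rewrite ReB ImB /=; have := xP n; have := yP n; lra.
Qed.

(** * Real-linear maps of the plane and their inverses *)

Section RealLinear.
Context {R : realType} (a b : R[i]).
Local Notation N := (@Normc.normc R).

Definition rlin (v : R[i]) : R[i] := a * v + b * conjc v.

(** Cramer's rule for w = a v + b conj(v) and its conjugate; the denominator |a|^2 - |b|^2 is the
    determinant of [rlin]. *)
Definition rlin_inv (w : R[i]) : R[i] :=
  (conjc a * w - b * conjc w) / (a * conjc a - b * conjc b).

Lemma rlinD v w : rlin (v + w) = rlin v + rlin w.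
Proof. by rewrite /rlin rmorphD; ring. Qed.

Lemma rlinN v : rlin (- v) = - rlin v.
Proof. by rewrite /rlin rmorphN; ring. Qed.

Lemma rlinB v w : rlin (v - w) = rlin v - rlin w.
Proof. by rewrite rlinD rlinN. Qed.

Lemma rlin_le v : N (rlin v) <= (N a + N b) * N v.
Proof.
apply: le_trans (normc_triangle _ _) _.
by rewrite !Normc.normcM normc_conj mulrDl.
Qed.

Lemma rlin_ge v : (N a - N b) * N v <= N (rlin v).
Proof.
apply: le_trans (normc_sub_ge _ _).
by rewrite !Normc.normcM normc_conj mulrBl.
Qed.

Hypothesis hab : N b < N a.

Lemma rlin_invK w : rlin (rlin_inv w) = w.
Proof.
have D0 : a * conjc a - b * conjc b != 0.
  rewrite subr_eq0; apply: contraTneq hab => /(congr1 N).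
  rewrite !Normc.normcM !normc_conj -!expr2 => /eqP.
  by rewrite eqrXn2 ?normc_ge0 // => /eqP ->; rewrite ltxx.
rewrite /rlin /rlin_inv fmorph_div !rmorphB !rmorphM /= !conjcK.
have D1 : conjc a * a - conjc b * b != 0 by rewrite mulrC (mulrC (conjc b)).
by field; exact: D1.
Qed.

Lemma rlin_invB v w : rlin_inv (v - w) = rlin_inv v - rlin_inv w.
Proof. by rewrite /rlin_inv rmorphB; ring. Qed.

Lemma rlin_inv_le w : (N a - N b) * N (rlin_inv w) <= N w.
Proof. by rewrite -{2}(rlin_invK w); exact: rlin_ge. Qed.

(** Both sides have the same image under [rlin], which is injective by its lower bound. *)
Lemma rlinI v : rlin_inv (rlin v) = v.
Proof.
apply/eqP; rewrite -subr_eq0; apply/eqP/Normc.eq0_normc/eqP.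
rewrite eq_le normc_ge0 andbT -(pmulr_rle0 _ (_ : 0 < N a - N b)) ?subr_gt0 //.
apply: le_trans (rlin_ge _) _.
by rewrite rlinB rlin_invK subrr Normc.normc0.
Qed.

End RealLinear.

Definition is_rlin {R : realType} (M : R[i] -> R[i]) : Prop :=
  exists p q, forall v, M v = rlin p q v.

Section RealLinearMaps.
Context {R : realType}.
Implicit Types M : R[i] -> R[i].
Local Notation N := (@Normc.normc R).

Lemma is_rlin_id : is_rlin (@id R[i]).
Proof. by exists 1, 0 => v; rewrite /rlin; ring. Qed.

Lemma is_rlin_rlin_inv a b : is_rlin (@rlin_inv R a b).
Proof.
exists (conjc a / (a * conjc a - b * conjc b)).
exists (- b / (a * conjc a - b * conjc b)) => v.
by rewrite /rlin /rlin_inv; ring.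
Qed.

Lemma is_rlinD M1 M2 : is_rlin M1 -> is_rlin M2 -> is_rlin (fun v => M1 v + M2 v).
Proof.
move=> [p [q Mp]] [p' [q' Mp']]; exists (p + p'), (q + q') => v.
by rewrite Mp Mp' /rlin; ring.
Qed.

Lemma is_rlinM M s : is_rlin M -> is_rlin (fun v => s * M v).
Proof. by move=> [p [q Mp]]; exists (s * p), (s * q) => v; rewrite Mp /rlin; ring. Qed.

Lemma is_rlin_comp M1 M2 : is_rlin M1 -> is_rlin M2 -> is_rlin (fun v => M1 (M2 v)).
Proof.
move=> [p [q Mp]] [p' [q' Mp']].
exists (p * p' + q * conjc q'), (p * q' + q * conjc p') => v.
by rewrite Mp Mp' /rlin rmorphD !rmorphM /= conjcK; ring.
Qed.

Lemma is_rlin_add M v w : is_rlin M -> M (v + w) = M v + M w.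
Proof. by move=> [p [q Mp]]; rewrite !Mp rlinD. Qed.

Lemma is_rlin_bound M : is_rlin M -> exists2 K, 0 <= K & forall v, N (M v) <= K * N v.
Proof.
move=> [p [q Mp]]; exists (N p + N q); first by rewrite addr_ge0 ?normc_ge0.
by move=> v; rewrite Mp rlin_le.
Qed.

End RealLinearMaps.

(** This is k-linearity at z. Holding for every positive [k], with [M] allowed to depend on [k], it
    amounts to real differentiability at z. *)
Definition lin_approx {R : realType} (eta : R[i] -> R[i]) (z : R[i]) (k : R) : Prop :=
  exists M d, [/\ is_rlin M, 0 < d & forall v, Normc.normc v < d ->
    Normc.normc (eta (z + v) - eta z - M v) <= k * Normc.normc v].

(** * The fixed-point operator and the bounds it preserves *)

Section FixedPoint.
Context {R : realType} (a b e c : R[i]) (r m B A : R).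
Local Notation C := R[i].
Local Notation N := (@Normc.normc R).
Local Notation L := (rlin a b).
Local Notation h := (affine_map a b e).
Local Notation f := (fun z : C => h z ^+ 2 + c).
Local Notation H := (N a + N b).
Local Notation l := (N a - N b).
Local Notation S := (N c + 1 + H ^+ 2).
Implicit Types (eta : C -> C) (z w v : C).

Hypothesis hab : N b < N a.
Hypothesis r1 : 1 <= r.
Hypothesis m0 : 0 < m.
Hypothesis B0 : 0 < B.
Hypothesis A1 : 1 <= A.
Hypothesis h_geB : forall z, r < N z -> B <= N (h z).
Hypothesis h_ge : forall z, r < N z -> m * N z <= N (h z).
Hypothesis f_ge : forall z, r < N z -> A * N z <= N (f z).
(** [B_sup] keeps the displacement at most 1 and [B_contr] yields the contraction factor 1/2.
    [B_slope1], [B_slope2] and [A_large] each control one third of the slope estimate. [B_large]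
    keeps h + L eta away from 0, and [A_large] also drives the self-improvement of k-linearity. *)
Hypothesis B_sup : S <= 2 * l * B.
Hypothesis B_contr : 1 + 2 * H ^+ 2 <= l * B.
Hypothesis B_slope1 : 3 * H ^+ 2 <= l * B.
Hypothesis B_slope2 : 3 * S * H <= 2 * m * l * B.
Hypothesis B_large : 3 * H <= B.
Hypothesis A_large : 12 * H <= l * A.

Let l0 : 0 < l. Proof. by rewrite subr_gt0. Qed.
Let H0 : 0 < H. Proof. by have := normc_ge0 b; move: hab; lra. Qed.

Lemma affineB z w : h z - h w = L (z - w).
Proof. by rewrite rlinB /affine_map /rlin; ring. Qed.

Lemma affineD z v : h (z + v) = h z + L v.
Proof. by rewrite /affine_map /rlin rmorphD; ring. Qed.

Let f_out z : r < N z -> r < N (f z).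
Proof.
move=> rz; apply: (lt_le_trans rz); apply: le_trans (f_ge rz).
by rewrite ler_peMl // normc_ge0.
Qed.

Let fB z w : f z - f w = L (z - w) * (h z + h w).
Proof. by rewrite -affineB; ring. Qed.

Let h_neq0 z : r < N z -> h z != 0.
Proof.
move=> rz; apply: contraTneq B0 => hz; rewrite -leNgt.
by have := h_geB rz; rewrite hz Normc.normc0.
Qed.

(* The fixed points of [conj_step] solve (h + L eta)^2 = f + eta o f, that is,
   h (psi z) ^ 2 = psi (f z) for psi z = z + eta z. *)
Definition conj_step eta z : C :=
  rlin_inv a b ((c + eta (f z) - L (eta z) ^+ 2) / (2%:R * h z)).

Definition small_disp eta := forall z, r < N z -> N (eta z) <= 1.

(** The case rho = min (|z|, |w|) is the two-point bound. A free [rho] avoids both the minimum and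
    division, and rho = r gives a Lipschitz constant 1/r. *)
Definition decaying_slope eta := forall rho z w, 0 < rho -> r < N z -> r < N w ->
  rho <= N z -> rho <= N w -> rho * N (eta z - eta w) <= N (z - w).

Let rlin_disp eta z : small_disp eta -> r < N z -> N (L (eta z)) <= H.
Proof.
move=> eta1 rz; apply: le_trans (rlin_le _ _ _) _.
by rewrite ler_piMr ?eta1 // ltW.
Qed.

Let numerator_le eta z : small_disp eta -> r < N z ->
  N (c + eta (f z) - L (eta z) ^+ 2) <= S.
Proof.
move=> eta1 rz; apply: le_trans (normc_triangleB _ _) _.
rewrite lerD //; first by rewrite (le_trans (normc_triangle _ _)) ?lerD ?eta1 ?f_out.
by rewrite normcX lerXn2r ?nnegrE ?normc_ge0 ?rlin_disp // ltW.
Qed.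

(* All estimates on [conj_step] are made after multiplying by 2 h z. *)
Let conj_step_le eta x z : r < N z ->
  l * (2 * N (h z)) * N (conj_step eta z - rlin_inv a b (x / (2%:R * h z))) <=
  N (c + eta (f z) - L (eta z) ^+ 2 - x).
Proof.
move=> rz; have hz := h_neq0 rz; have hz0 := normc_gt0 hz.
rewrite /conj_step -rlin_invB -mulrBl mulrAC.
have N2 (y : C) : N (y / (2%:R * h z)) * (2 * N (h z)) = N y.
  rewrite Normc.normcM Normc.normcV Normc.normcM normc_nat divfK //.
  by rewrite mulf_neq0 ?gt_eqF.
by rewrite -[X in _ <= X]N2 ler_pM2r ?mulr_gt0 ?rlin_inv_le.
Qed.

Lemma conj_step_small eta : small_disp eta -> small_disp (conj_step eta).
Proof.
move=> eta1 z rz; have := conj_step_le eta 0 rz.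
rewrite mul0r subr0.
have -> : rlin_inv a b 0 = 0 by rewrite /rlin_inv conjc0; ring.
rewrite subr0 => /le_trans/(_ (numerator_le eta1 rz)) le1.
have hB := h_geB rz.
have P : 0 < l * (2 * N (h z)) by rewrite !mulr_gt0 // (lt_le_trans B0).
rewrite -(ler_pM2l P) (le_trans le1) // mulr1 (le_trans B_sup) //.
by rewrite mulrCA mulrA ler_pM2l // mulr_gt0.
Qed.

(** The numerators differ by at most (1 + 2 H^2) d: the term at f z contributes d, and the
    difference of squares factors into at most (H d) (2 H). [B_contr] absorbs this constant. *)
Lemma conj_step_contraction eta eta' d z :
  small_disp eta -> small_disp eta' ->
  (forall z, r < N z -> N (eta z - eta' z) <= d) ->
  r < N z -> 2 * N (conj_step eta z - conj_step eta' z) <= d.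
Proof.
move=> eta1 eta1' dist rz.
have := conj_step_le eta (c + eta' (f z) - L (eta' z) ^+ 2) rz.
rewrite -/(conj_step eta' z) => le1.
have d0 : 0 <= d := le_trans (normc_ge0 _) (dist _ rz).
have le2 : N (c + eta (f z) - L (eta z) ^+ 2 - (c + eta' (f z) - L (eta' z) ^+ 2))
    <= d + 2 * H ^+ 2 * d.
  have -> : c + eta (f z) - L (eta z) ^+ 2 - (c + eta' (f z) - L (eta' z) ^+ 2) =
     (eta (f z) - eta' (f z)) - L (eta z - eta' z) * (L (eta z) + L (eta' z)).
    by rewrite rlinB; ring.
  apply: le_trans (normc_triangleB _ _) _; rewrite lerD ?dist ?f_out //.
  rewrite Normc.normcM.
  have : N (L (eta z - eta' z)) <= H * d.
    by apply: le_trans (rlin_le _ _ _) _; rewrite ler_pM2l ?dist.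
  have : N (L (eta z) + L (eta' z)) <= 2 * H.
    rewrite mulr_natl mulr2n (le_trans (normc_triangle _ _)) //.
    by rewrite lerD ?rlin_disp.
  have -> : 2 * H ^+ 2 * d = H * d * (2 * H) by ring.
  by move=> ? ?; rewrite ler_pM ?normc_ge0.
have lB : 1 + 2 * H ^+ 2 <= l * N (h z).
  by rewrite (le_trans B_contr) // ler_pM2l ?h_geB.
have lp : 0 < l * N (h z) by rewrite mulr_gt0 // (lt_le_trans B0) ?h_geB.
rewrite -(ler_pM2l lp) mulrA -[_ * 2]mulrA [_ * 2]mulrC.
apply: le_trans le1 _; apply: le_trans le2 _.
by rewrite -{1}(mul1r d) -mulrDl ler_wpM2r.
Qed.

(** The difference splits into three terms: the increment of eta between f z and f w, the increment
    of the square, and the change of denominator. Each is at most a third of the allowed amount. *)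
Lemma conj_step_slope eta : small_disp eta -> decaying_slope eta ->
  decaying_slope (conj_step eta).
Proof.
move=> eta1 etaS rho z w rho0 rz rw rhoz rhow.
(* This ordering makes |h z + h w| at most 2 |h z|, to be matched with the factor 2 |h z| of
   [conj_step_le]. *)
wlog hle : z w rz rw rhoz rhow / N (h w) <= N (h z).
  move=> W; case: (leP (N (h w)) (N (h z))) => [|/ltW] hzw; first exact: W.
  by rewrite normc_distC (normc_distC z); exact: W.
have hz := h_neq0 rz; have hw := h_neq0 rw.
have hz0 := normc_gt0 hz; have hw0 := normc_gt0 hw.
(* To compare over the single denominator 2 h z, the numerator at w is rescaled by h z / h w; the
   rescaling costs the term L (z - w) / h w * nw. *)
set nw := c + eta (f w) - L (eta w) ^+ 2.
have := conj_step_le eta (nw * (h z / h w)) rz.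
have -> : nw * (h z / h w) / (2%:R * h z) = nw / (2%:R * h w).
  by field; rewrite hz hw.
rewrite -/(conj_step eta w) => le1.
set D := N (z - w).
have D0 : 0 <= D by exact: normc_ge0.
have LD : N (L (z - w)) <= H * D by exact: rlin_le.
have le2 : N (c + eta (f z) - L (eta z) ^+ 2 - nw * (h z / h w)) <=
    N (eta (f z) - eta (f w)) + N (L (eta z - eta w)) * (2 * H)
    + N (L (z - w)) / N (h w) * S.
  have -> : c + eta (f z) - L (eta z) ^+ 2 - nw * (h z / h w) =
    (eta (f z) - eta (f w)) - L (eta z - eta w) * (L (eta z) + L (eta w))
    - L (z - w) / h w * nw.
    by rewrite /nw -(affineB z w) rlinB; field.
  apply: le_trans (normc_triangleB _ _) _; apply: lerD.
    apply: le_trans (normc_triangleB _ _) _; rewrite lerD2l Normc.normcM.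
    rewrite ler_wpM2l ?normc_ge0 // mulr_natl mulr2n.
    by rewrite (le_trans (normc_triangle _ _)) // lerD ?rlin_disp.
  rewrite !Normc.normcM Normc.normcV ler_wpM2l ?numerator_le //.
  by rewrite mulr_ge0 ?invr_ge0 ?normc_ge0.
set X := N (h z) in le1 hz0 hle *.
(* The slope bound is used at f z and f w with the larger weight A rho, available because f expands
   moduli by A. *)
have t1 : A * (rho * N (eta (f z) - eta (f w))) <= H * D * (2 * X).
  rewrite mulrA; apply: (@le_trans _ _ (N (f z - f w))).
    have A0 : 0 < A := lt_le_trans ltr01 A1.
    apply: etaS (mulr_gt0 A0 rho0) (f_out rz) (f_out rw) _ _.
      by apply: le_trans (f_ge rz); rewrite ler_pM2l.
    by apply: le_trans (f_ge rw); rewrite ler_pM2l.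
  rewrite fB Normc.normcM ler_pM ?normc_ge0 //.
  by rewrite (le_trans (normc_triangle _ _)) // mulr_natl mulr2n lerD2l.
have t2 : rho * N (L (eta z - eta w)) <= H * D.
  apply: (@le_trans _ _ (H * (rho * N (eta z - eta w)))).
    by rewrite mulrCA ler_pM2l // rlin_le.
  by rewrite ler_pM2l // etaS.
(* The weight cancels against |h w| >= m |w| >= m rho. *)
have t3 : m * (rho * (N (L (z - w)) / N (h w))) <= H * D.
  rewrite !mulrA ler_pdivrMr // mulrC; apply: ler_pM; rewrite ?normc_ge0 //.
    by rewrite mulr_ge0 ?ltW.
  apply: le_trans (h_ge rw); by rewrite ler_pM2l.
have {}le1 := le_trans le1 le2.
have key : l * (2 * X) * (rho * N (conj_step eta z - conj_step eta w)) <=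
   l * (2 * X) * D.
  rewrite mulrCA; apply: le_trans (ler_wpM2l (ltW rho0) le1) _.
  rewrite !mulrDr.
  have hB := h_geB rz; rewrite -/X in hB.
  have HD0 : 0 <= H * D by rewrite mulr_ge0 // ltW.
  have A0 : 0 < A by rewrite (lt_le_trans ltr01).
  have s1 : 3 * (rho * N (eta (f z) - eta (f w))) <= l * (2 * X) * D.
    rewrite -(ler_pM2l A0) mulrCA.
    apply: le_trans (ler_wpM2l (ler0n _ 3) t1) _.
    have -> : 3 * (H * D * (2 * X)) = 3 * H * (2 * X * D) by ring.
    have -> : A * (l * (2 * X) * D) = (l * A) * (2 * X * D) by ring.
    by rewrite ler_wpM2r ?mulr_ge0 ?(ltW hz0) //; move: A_large H0; lra.
  have s2 : 3 * (rho * (N (L (eta z - eta w)) * (2 * H))) <= l * (2 * X) * D.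
    rewrite (mulrA rho).
    apply: (@le_trans _ _ (3 * (H * D * (2 * H)))).
      by rewrite ler_pM2l // ler_wpM2r // mulr_ge0 // ltW.
    have -> : 3 * (H * D * (2 * H)) = 3 * H ^+ 2 * (2 * D) by ring.
    have -> : l * (2 * X) * D = l * X * (2 * D) by ring.
    by rewrite ler_wpM2r ?mulr_ge0 // (le_trans B_slope1) // ler_pM2l.
  have S0 : 0 <= S by rewrite !addr_ge0 ?normc_ge0 ?sqr_ge0.
  have s3 : 3 * (rho * (N (L (z - w)) / N (h w) * S)) <= l * (2 * X) * D.
    rewrite -(ler_pM2l m0).
    have -> : m * (3 * (rho * (N (L (z - w)) / N (h w) * S))) =
      (3 * S) * (m * (rho * (N (L (z - w)) / N (h w)))) by ring.
    apply: (@le_trans _ _ (3 * S * (H * D))); first by rewrite ler_wpM2l ?mulr_ge0.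
    have -> : m * (l * (2 * X) * D) = (2 * m * l * X) * D by ring.
    rewrite mulrA ler_wpM2r // (le_trans B_slope2) // ler_pM2l ?mulr_gt0 //.
  by move: s1 s2 s3; lra.
by rewrite ler_pM2l ?mulr_gt0 in key.
Qed.

(** * Convergence of the iterates and the functional equation *)

Definition conj_iter n : C -> C := iter n conj_step (fun=> 0).

Let conj_iter_small n : small_disp (conj_iter n).
Proof.
elim: n => [|n IH]; last exact: conj_step_small.
by move=> z _; rewrite Normc.normc0.
Qed.

Let conj_iter_slope n : decaying_slope (conj_iter n).
Proof.
elim: n => [|n IH]; last exact: conj_step_slope.
by move=> rho z w *; rewrite subrr Normc.normc0 mulr0 normc_ge0.
Qed.

Let conj_iter_geometric n z : r < N z ->
  N (conj_iter n.+1 z - conj_iter n z) <= 2^-1 ^+ n.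
Proof.
elim: n z => [|n IH] z rz.
  by rewrite subr0 expr0; exact: conj_iter_small.
rewrite exprS mulrC ler_pdivlMr // mulrC.
exact: (@conj_step_contraction (conj_iter n.+1) (conj_iter n)).
Qed.

(** Iterates from 0 converge geometrically, at a rate independent of the point. The bounds pass to
    the limit up to multiples of 2^-n, and the contraction estimate carries over the fixed-point
    equation. *)
Lemma conj_fixed_point : exists eta,
  [/\ small_disp eta, decaying_slope eta &
      forall z, r < N z -> conj_step eta z = eta z].
Proof.
have [eta etaP] : exists eta, forall z, r < N z ->
    forall n, N (conj_iter n z - eta z) <= 4 * 2^-1 ^+ n.
  have : forall z, exists l, r < N z ->
      forall n, N (conj_iter n z - l) <= 4 * 2^-1 ^+ n.
    move=> z; have [rz|_] := boolP (r < N z); last by exists 0.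
    have [|l lP] := @geometric_limit_complex _ (conj_iter^~ z).
      by move=> n; exact: conj_iter_geometric.
    by exists l.
  by move=> /choice[eta etaP]; exists eta.
have eta1 : small_disp eta.
  move=> z rz; apply: (@le_of_geometric _ _ _ 4) => n.
  have := normc_triangleB (conj_iter n z) (conj_iter n z - eta z).
  have := etaP z rz n; have := conj_iter_small n rz.
  by rewrite subKr; lra.
exists eta; split => //.
  move=> rho z w rho0 rz rw rhoz rhow.
  apply: (@le_of_geometric _ _ _ (8 * rho)) => n.
  have -> : 8 * rho * 2^-1 ^+ n = rho * (8 * 2^-1 ^+ n) by ring.
  have := conj_iter_slope n rho0 rz rw rhoz rhow.
  have : N (eta z - eta w) <= N (conj_iter n z - conj_iter n w) + 8 * 2^-1 ^+ n.
    have -> : eta z - eta w = (conj_iter n z - conj_iter n w)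
      - ((conj_iter n z - eta z) - (conj_iter n w - eta w)) by ring.
    have := normc_triangleB (conj_iter n z - conj_iter n w)
       ((conj_iter n z - eta z) - (conj_iter n w - eta w)).
    have := normc_triangleB (conj_iter n z - eta z) (conj_iter n w - eta w).
    by have := etaP z rz n; have := etaP w rw n; lra.
  by move=> /(ler_wpM2l (ltW rho0)); rewrite mulrDr; lra.
move=> z rz; apply/eqP; rewrite -subr_eq0; apply/eqP/Normc.eq0_normc/eqP.
rewrite eq_le normc_ge0 andbT; apply: (@le_of_geometric _ _ _ 8) => n.
have := @conj_step_contraction (conj_iter n) eta _ z (@conj_iter_small n) eta1
   (fun z rz => etaP z rz n) rz.
have := etaP z rz n.+1; rewrite exprS -/(conj_step (conj_iter n)).
have -> : conj_step eta z - eta z = (conj_iter n.+1 z - eta z)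
   - (conj_step (conj_iter n) z - conj_step eta z) by rewrite /conj_iter /=; ring.
have := normc_triangleB (conj_iter n.+1 z - eta z)
  (conj_step (conj_iter n) z - conj_step eta z).
have : 0 <= 2^-1 ^+ n :> R by rewrite exprn_ge0.
by lra.
Qed.

Let fixed_functional_eq eta z : r < N z -> conj_step eta z = eta z ->
  (h z + L (eta z)) ^+ 2 = f z + eta (f z).
Proof.
move=> rz etaE; have hz := h_neq0 rz.
have LE : L (eta z) * (2%:R * h z) = c + eta (f z) - L (eta z) ^+ 2.
  by rewrite -{1}etaE /conj_step rlin_invK // divfK // mulf_neq0 ?pnatr_eq0.
have -> : (h z + L (eta z)) ^+ 2 =
   h z ^+ 2 + L (eta z) ^+ 2 + L (eta z) * (2%:R * h z) by ring.
by rewrite LE; ring.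
Qed.

(** * Differentiability of the displacement *)

Let stay_out z v : N v < N z - r -> r < N (z + v).
Proof. by have := normc_sub_ge z v; lra. Qed.

(** The zero map serves as approximation: for |v| < |z| / 2 both z and z + v have modulus at least
    |z| / 2, a legitimate weight in the slope bound. *)
Let approx_init eta z : decaying_slope eta -> r < N z -> lin_approx eta z (2 / N z).
Proof.
move=> etaS rz; have z0 : 0 < N z by move: r1; lra.
exists (fun v => 0 * v), (Num.min (N z - r) (N z / 2)); split.
- by apply: is_rlinM is_rlin_id.
- by rewrite lt_min !subr_gt0 rz divr_gt0.
move=> v; rewrite lt_min => /andP[vr vz]; rewrite mul0r subr0.
have rzv := stay_out vr.
have zv2 : N z / 2 <= N (z + v) by have := normc_sub_ge z v; lra.
have z20 : 0 < N z / 2 by rewrite divr_gt0.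
have le1 : N z / 2 * N (eta (z + v) - eta z) <= N v.
  have := etaS _ (z + v) z z20 rzv rz zv2.
  by rewrite [z + v - z]addrC addKr; apply; lra.
rewrite -(ler_pM2l z20); apply: le_trans le1 _.
suff -> : N z / 2 * (2 / N z * N v) = N v by [].
by field; rewrite gt_eqF.
Qed.

(* With u = h + L eta the equation reads u ^ 2 = f + eta o f, so increments
   satisfy (u w + u z) (u w - u z) = (f + eta) (f w) - (f + eta) (f z); hence
   only the approximation at f z enters, and none at z. *)
Let approx_step eta z k : small_disp eta -> decaying_slope eta ->
  (forall z, r < N z -> conj_step eta z = eta z) ->
  r < N z -> 0 < k -> lin_approx eta (f z) k -> lin_approx eta z (3 * H * k / l).
Proof.
move=> eta1 etaS etaE rz k0 [M [d [Mlin d0 Mapprox]]].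
pose u w := h w + L (eta w).
have hz := h_neq0 rz; have X0 := normc_gt0 hz; set X := N (h z) in X0.
have XH : 3 * H <= X by apply: le_trans B_large _; exact: h_geB.
have Lbound w : r < N w -> N (L (eta w)) <= H by exact: rlin_disp.
have uz : u z != 0.
  apply/eqP => uz0; have := normc_sub_ge (h z) (L (eta z)).
  by rewrite -/(u z) uz0 Normc.normc0 -/X; have := Lbound z rz; move: H0 XH; lra.
(* [E] approximates the increments of id + eta at f z. Linearizing u^2 = (id + eta) o f at z then
   gives 2 u(z) D v = E (2 h(z) L v), which dictates [D]. *)
pose E y := y + M y.
have Elin : is_rlin E by apply: is_rlinD is_rlin_id Mlin.
pose D v := (2%:R * u z)^-1 * E (2%:R * h z * L v).
have Llin : is_rlin L by exists a, b.
have Dlin : is_rlin D.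
  by apply: is_rlinM; apply: is_rlin_comp Elin _; exact: is_rlinM.
have [KE KE0 EK] := is_rlin_bound Elin; have [KD KD0 DK] := is_rlin_bound Dlin.
pose K := KE * H ^+ 2 + 2 * H * KD.
have K0 : 0 <= K.
  by rewrite addr_ge0 ?mulr_ge0 ?sqr_ge0 ?(ltW H0).
(* The increment of u is L applied to v plus the increment of eta, so [D] is undone by L^-1 and v is
   subtracted. *)
exists (fun v => rlin_inv a b (D v) + (-1) * v).
(* In order: z + v stays in the domain; |L v| <= H; f (z + v) stays within [d] of f z; the quadratic
   error K |v|^2 is at most half of k H Q |v|. The shift in K + 1 avoids a zero denominator. *)
exists (Num.min (Num.min (N z - r) 1)
  (Num.min (d / (H * (2 * X + H))) (k * H * X / (2 * (K + 1))))).
have HX0 : 0 < H * (2 * X + H) by rewrite mulr_gt0 // addr_gt0 // mulr_gt0.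
have K1 : 0 < 2 * (K + 1) by move: K0; lra.
split.
- apply: is_rlinD; last exact: is_rlinM is_rlin_id.
  by apply: is_rlin_comp Dlin; exact: is_rlin_rlin_inv.
- by rewrite !lt_min subr_gt0 rz ltr01 !divr_gt0 // !mulr_gt0.
move=> v; rewrite !lt_min => /andP[/andP[vr v1] /andP[vd vk]].
set V := N v in vr v1 vd vk *; have V0 : 0 <= V by exact: normc_ge0.
have rw := stay_out vr; set w := z + v in rw *.
have hw : h w = h z + L v by rewrite affineD.
have LV : N (L v) <= H * V by exact: rlin_le.
have LVH : N (L v) <= H by rewrite (le_trans LV) // ler_piMr // ltW.
set Q := N (2%:R * h z + L v).
have QX : X <= Q.
  have := normc_sub_ge (2%:R * h z) (L v).
  by rewrite Normc.normcM normc_nat -/Q -/X; move: LVH XH H0; lra.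
have Q4 : 4 * H <= Q.
  have := normc_sub_ge (2%:R * h z) (L v).
  by rewrite Normc.normcM normc_nat -/Q -/X; move: LVH XH H0; lra.
have Q2 : Q <= 2 * X + H.
  apply: le_trans (normc_triangle _ _) _.
  by rewrite Normc.normcM normc_nat lerD2l.
have uQ : Q / 2 <= N (u w + u z).
  have -> : u w + u z = 2%:R * h z + L v + (L (eta w) + L (eta z)).
    by rewrite /u hw; ring.
  have := normc_sub_ge (2%:R * h z + L v) (L (eta w) + L (eta z)).
  have := normc_triangle (L (eta w)) (L (eta z)).
  by rewrite -/Q; have := Lbound z rz; have := Lbound w rw; move: Q4; lra.
pose Y := f w - f z.
have YE : Y = 2%:R * h z * L v + L v ^+ 2 by rewrite /Y hw; ring.
have YQ : N Y <= H * V * Q.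
  have -> : Y = L v * (2%:R * h z + L v) by rewrite YE; ring.
  by rewrite Normc.normcM ler_wpM2r ?normc_ge0.
have Yd : N Y < d.
  apply: le_lt_trans YQ _; rewrite ltr_pdivlMr // in vd.
  apply: le_lt_trans vd; rewrite mulrA (mulrC V); rewrite ler_wpM2l ?mulr_ge0 // ltW //.
have err : N (eta (f w) - eta (f z) - M Y) <= k * N Y.
  have fY : f w = f z + Y by rewrite /Y; ring.
  by rewrite fY; exact: Mapprox.
have slope1 : N (eta w - eta z) <= V.
  have z0 : 0 < r by exact: lt_le_trans r1.
  have := etaS r w z z0 rw rz (ltW rw) (ltW rz).
  rewrite /w [z + v - z]addrC addKr; apply: le_trans.
  by rewrite ler_peMl ?normc_ge0.
pose du := u w - u z.
have duE : du = L v + L (eta w - eta z) by rewrite /du /u hw rlinB; ring.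
have duV : N du <= 2 * H * V.
  rewrite duE; apply: le_trans (normc_triangle _ _) _.
  have : N (L (eta w - eta z)) <= H * V.
    by apply: le_trans (rlin_le _ _ _) _; rewrite ler_pM2l.
  by move: LV; lra.
have DE : E (2%:R * h z * L v) = 2%:R * u z * D v.
  by rewrite /D mulrA divff ?mul1r // mulf_neq0 ?pnatr_eq0.
have key : (u w + u z) * (du - D v) =
    E (L v ^+ 2) + (eta (f w) - eta (f z) - M Y) - du * D v.
  have -> : (u w + u z) * (du - D v) =
     u w ^+ 2 - u z ^+ 2 - 2%:R * u z * D v - du * D v by rewrite /du; ring.
  rewrite -DE !fixed_functional_eq ?etaE //.
  have -> : f w + eta (f w) - (f z + eta (f z)) = Y + (eta (f w) - eta (f z)).
    by rewrite /Y; ring.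
  have : E Y = E (2%:R * h z * L v) + E (L v ^+ 2) by rewrite YE is_rlin_add.
  rewrite {1}/E => EY.
  have -> : E (2%:R * h z * L v) = Y + M Y - E (L v ^+ 2) by rewrite EY addrK.
  by ring.
have bound : Q / 2 * N (du - D v) <= K * V ^+ 2 + k * (H * V * Q).
  apply: (@le_trans _ _ (N ((u w + u z) * (du - D v)))).
    by rewrite Normc.normcM ler_wpM2r ?normc_ge0.
  rewrite key; apply: le_trans (normc_triangleB _ _) _.
  have e1 : N (E (L v ^+ 2)) <= KE * H ^+ 2 * V ^+ 2.
    apply: le_trans (EK _) _; rewrite -mulrA ler_wpM2l // normcX -exprMn.
    by rewrite lerXn2r ?nnegrE ?normc_ge0 // mulr_ge0 // ltW.
  have e2 : N (du * D v) <= 2 * H * KD * V ^+ 2.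
    have -> : 2 * H * KD * V ^+ 2 = 2 * H * V * (KD * V) by ring.
    by rewrite Normc.normcM ler_pM ?normc_ge0 // DK.
  have e3 : N (eta (f w) - eta (f z) - M Y) <= k * (H * V * Q).
    by apply: le_trans err _; rewrite ler_pM2l.
  have := normc_triangle (E (L v ^+ 2)) (eta (f w) - eta (f z) - M Y).
  by rewrite /K; move: e1 e2 e3; lra.
have KV : K * V ^+ 2 <= k * H * Q * V / 2.
  rewrite ltr_pdivlMr // in vk.
  have : V * K <= k * H * Q / 2.
    have : k * H * X <= k * H * Q by rewrite ler_pM2l ?mulr_gt0.
    by move: vk V0; lra.
  by move=> /(ler_wpM2l V0); rewrite expr2; lra.
have Q0 : 0 < Q by exact: lt_le_trans X0 QX.
(* The errors add up to (1 + 1/2) k H Q |v|; dividing by Q / 2 produces the factor 3. *)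
have duD : N (du - D v) <= 3 * H * k * V.
  have Q20 : 0 < Q / 2 by rewrite divr_gt0.
  rewrite -(ler_pM2l Q20); apply: le_trans bound _.
  by move: KV; lra.
have -> : eta w - eta z - (rlin_inv a b (D v) + -1 * v) = rlin_inv a b (du - D v).
  by rewrite rlin_invB duE -rlinD rlinI //; ring.
rewrite mulrAC ler_pdivlMr // mulrC.
by apply: le_trans (rlin_inv_le hab _) _.
Qed.

Lemma conj_displacement : exists eta,
  [/\ small_disp eta, decaying_slope eta,
      forall z, r < N z -> h (z + eta z) ^+ 2 = f z + eta (f z) &
      forall z k, r < N z -> 0 < k -> lin_approx eta z k].
Proof.
have [eta [eta1 etaS etaE]] := conj_fixed_point.
exists eta; split => // [z rz|z k rz k0].
  by rewrite affineD fixed_functional_eq ?etaE.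
have z0 y : r < N y -> 0 < N y by move: r1; lra.
(* Carrying 1 / |y| in the constant lets |f y| >= A |y| win a factor A at each step, and A >= 12 H /
   l beats the loss 3 H / l with room for the halving. *)
have approx n y : r < N y -> lin_approx eta y (2 * 2^-1 ^+ n / N y).
  elim: n y => [|n IH] y ry; first by rewrite expr0 mulr1; exact: approx_init.
  have fy := f_out ry; have y0 := z0 _ ry; have fy0 := z0 _ fy.
  have p0 : 0 < 2^-1 ^+ n :> R by rewrite exprn_gt0.
  have [|M [d [Mlin d0 MP]]] := approx_step eta1 etaS etaE ry _ (IH _ fy).
    by rewrite divr_gt0 ?mulr_gt0.
  exists M, d; split => // v vd; apply: le_trans (MP v vd) _.
  rewrite ler_wpM2r ?normc_ge0 // ler_pdivlMr //.
  have -> : 3 * H * (2 * 2^-1 ^+ n / N (f y)) / l * N y =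
      6 * H * N y * 2^-1 ^+ n / (l * N (f y)) by field; rewrite !gt_eqF.
  rewrite ler_pdivrMr ?mulr_gt0 //.
  have le12 : 12 * H * N y <= l * N (f y).
    apply: (@le_trans _ _ (l * (A * N y))); last by rewrite ler_pM2l ?f_ge.
    by rewrite mulrA ler_pM2r.
  have HN : 0 <= H * N y by rewrite mulr_ge0 // ltW.
  have : 12 * H * N y * 2^-1 ^+ n <= l * N (f y) * 2^-1 ^+ n by rewrite ler_pM2r.
  have : 0 <= H * N y * 2^-1 ^+ n by rewrite mulr_ge0 // ltW.
  by rewrite (exprS 2^-1 n); move: (2^-1 ^+ n) => p; lra.
have [n nk] := geometric_small (2 / N z) k0.
have [M [d [Mlin d0 MP]]] := approx n z rz.
exists M, d; split => // v vd; apply: le_trans (MP v vd) _.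
by rewrite ler_wpM2r ?normc_ge0 // mulrAC.
Qed.

End FixedPoint.

(** * Integrability, absolute continuity and openness criteria *)

(* The library's monotonicity lemma asks for measurability of the integrand;
   comparing the defining suprema over simple functions does without it. *)
Lemma integral_bounded_lty d (T : measurableType d) (R : realType)
    (mu : {measure set T -> \bar R}) (D : set T) (g : T -> R) (K : R) :
  measurable D -> (mu D < +oo)%E -> (forall x, D x -> 0 <= g x <= K) -> 0 <= K ->
  (\int[mu]_(x in D) (g x)%:E < +oo)%E.
Proof.
move=> mD muD gK K0.
apply: (@le_lt_trans _ _ (\int[mu]_(x in D) (cst K%:E) x)%E); last first.
  rewrite integral_cst // lte_mul_pinfty // lee_fin.
rewrite !(integral_mkcond D) ge0_integralTE; last first.
  by apply: erestrict_ge0 => x Dx; have /andP[g0 _] := gK x Dx; rewrite lee_fin.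
rewrite ge0_integralTE; last first.
  by apply: erestrict_ge0 => x _; rewrite lee_fin.
apply: le_ereal_sup => _ [s /= sg <-]; exists s => //.
move=> x; apply: le_trans (sg x) _.
by apply: lee_restrict => y Dy; have /andP[_ gy] := gK y Dy; rewrite lee_fin.
Qed.

Lemma lipschitz_abs_continuous (R : realType) (a b K : R) (g : R -> R[i]) : 0 < K ->
  (forall s t, a <= s -> s <= t -> t <= b ->
     Normc.normc (g t - g s) <= K * (t - s)) ->
  abs_continuous_on a b g.
Proof.
move=> K0 gK eps eps0; exists (eps / K); first by rewrite divr_gt0.
move=> s sab _; rewrite ltr_pdivlMr // => /(le_lt_trans _); apply.
rewrite mulr_suml big_seq [leRHS]big_seq; apply: ler_sum => p /sab[? [? ?]].
by rewrite mulrC gK.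
Qed.

Lemma ltcR_norm (R : realType) (z : R[i]) (t : R) : (`|z| < t%:C) = (Normc.normc z < t).
Proof. by rewrite -ltcR. Qed.

Lemma open_normc_gt (R : realType) (rho : R) :
  open ([set z : R[i] | rho < Normc.normc z] : set R[i]^o).
Proof.
rewrite openE => z /= rz; apply/nbhs_ballP.
exists (Normc.normc z - rho)%:C => /=; first by rewrite ltcR subr_gt0.
move=> w; rewrite -ball_normE /= ltcR_norm => wz.
have := normc_sub_ge z (w - z); rewrite normc_distC.
have -> : z + (w - z) = w by ring.
by move: wz; lra.
Qed.

(** * Quasiconformality of a perturbation of the identity *)

Section NearIdentity.
Context {R : realType} (r : R) (eta : R[i] -> R[i]).
Local Notation C := R[i].
Local Notation N := (@Normc.normc R).
Local Notation U := [set z : C | r < N z].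
Local Notation psi := (fun z : C => z + eta z).
Local Notation area := (@lebesgue_measure R \x @lebesgue_measure R)%E.
Hypothesis r10 : 10 <= r.
Hypothesis eta_slope : decaying_slope r eta.
Hypothesis eta_approx : forall z k, r < N z -> 0 < k -> lin_approx eta z k.

Let stay_out rho z v : N v < N z - rho -> rho < N (z + v).
Proof. by have := normc_sub_ge z v; lra. Qed.

Let eta_lip z w : r < N z -> r < N w -> N (eta z - eta w) <= 10^-1 * N (z - w).
Proof.
move=> rz rw; rewrite mulrC ler_pdivlMr // mulrC.
by apply: eta_slope; rewrite // (le_trans r10) // ltW.
Qed.

Let psi_lip z w : r < N z -> r < N w -> N (psi z - psi w) <= 2 * N (z - w).
Proof.
move=> rz rw; have -> : psi z - psi w = (z - w) + (eta z - eta w) by ring.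
have := normc_triangle (z - w) (eta z - eta w); have := eta_lip rz rw.
by have := normc_ge0 (z - w); lra.
Qed.

Lemma near_id_injective : {in U &, injective psi}.
Proof.
move=> z w; rewrite !inE /= => rz rw zw.
have E : z - w = eta w - eta z.
  by apply/eqP; rewrite -subr_eq0; apply/eqP; rewrite -(subrr (psi w)) -{1}zw; ring.
apply/eqP; rewrite -subr_eq0; apply/eqP/Normc.eq0_normc.
have := eta_lip rw rz; rewrite -E normc_distC.
by have := normc_ge0 (w - z); lra.
Qed.

(** One statement for all four real partial derivatives: [P] is the real or imaginary part and [u]
    is 1 or i. [eta_approx] gives existence of the derivative, the slope bound its size. *)
Let slice_derive1 (P : C -> R) (F : R -> C) x z u rho :
  (forall v w, P (v + w) = P v + P w) -> (forall v, `|P v| <= N v) ->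
  (forall t v, P (t%:C * v) = t * P v) ->
  (forall t, F (t + x) = z + t%:C * u) -> N u = 1 -> r < N z -> 0 < rho < N z ->
  `|derive1 (fun t => P (psi (F t))) x - P u| <= rho^-1.
Proof.
move=> PD PN PZ Fz u1 rz /andP[rho0 rhoz].
have F0 : F x = z by rewrite -{1}(add0r x) Fz mul0r addr0.
have Nu t : N (t%:C * u) = `|t| by rewrite Normc.normcM u1 mulr1 normc_real.
have PB v w : P (v - w) = P v - P w.
  have := PD (v - w) w; rewrite subrK => ->; ring.
have incr t : P (psi (F (t + x))) - P (psi (F x)) - P u * t =
    P (eta (z + t%:C * u) - eta z).
  by rewrite F0 Fz PB !PD PZ; ring.
apply: (@derive1_dist _ _ _ _ _ (Num.min (N z - r) (N z - rho))).
- move=> eps /(eta_approx rz)[M [d [[p [q Mpq]] d0 MP]]].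
  exists (P u + P (M u)), d; split => // t td.
  rewrite mulrDl opprD addrA incr.
  have -> : P (M u) * t = P (M (t%:C * u)).
    rewrite mulrC -PZ; congr P.
    have cJ : conjc (t%:C * u) = t%:C * conjc u by case: (u) => ? ?; simpc.
    by rewrite !Mpq /rlin cJ; ring.
  rewrite -PB (le_trans (PN _)) // -(Nu t); apply: MP; by rewrite Nu.
- by rewrite lt_min !subr_gt0 rz.
move=> t; rewrite lt_min -(Nu t) => /andP[/stay_out tr /stay_out trho].
rewrite incr (le_trans (PN _)) // [rho^-1 * _]mulrC ler_pdivlMr // mulrC.
have := eta_slope rho0 tr rz (ltW trho) (ltW rhoz).
by rewrite [_ + _ - z]addrC addKr.
Qed.

Let ReD (v w : C) : complex.Re (v + w) = complex.Re v + complex.Re w.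
Proof. by case: v w => [? ?] []. Qed.

Let ImD (v w : C) : complex.Im (v + w) = complex.Im v + complex.Im w.
Proof. by case: v w => [? ?] []. Qed.

Let ReZ t (v : C) : complex.Re (t%:C * v) = t * complex.Re v.
Proof. by case: v => x y /=; rewrite mul0r subr0. Qed.

Let ImZ t (v : C) : complex.Im (t%:C * v) = t * complex.Im v.
Proof. by case: v => x y /=; rewrite mul0r addr0. Qed.

(** A fixed rho = 10 gives the uniform bounds, a large [rho] the decay at infinity. Strictness of
    rho < |z| leaves a neighbourhood of z where the weight [rho] is allowed. *)
Lemma near_id_partial_x z rho : r < N z -> 0 < rho < N z ->
  `|complex.Re (partial_x psi z) - 1| <= rho^-1 /\
  `|complex.Im (partial_x psi z)| <= rho^-1.
Proof.
move=> rz rhoz; pose F t : C := t +i* complex.Im z.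
have Fz t : F (t + complex.Re z) = z + t%:C * 1.
  by rewrite mulr1 /F; case: z {rz rhoz F} => x y /=;
    rewrite addrC /real_complex_def /= /GRing.add /= addr0.
split.
  have := @slice_derive1 _ F _ _ _ _ ReD (@normc_ge_absRe R) ReZ Fz (@Normc.normc1 R) rz rhoz.
  by [].
have := @slice_derive1 _ F _ _ _ _ ImD (@normc_ge_absIm R) ImZ Fz (@Normc.normc1 R) rz rhoz.
by rewrite /= subr0.
Qed.

Lemma near_id_partial_y z rho : r < N z -> 0 < rho < N z ->
  `|complex.Re (partial_y psi z)| <= rho^-1 /\
  `|complex.Im (partial_y psi z) - 1| <= rho^-1.
Proof.
move=> rz rhoz; pose F t : C := complex.Re z +i* t.
have Fz t : F (t + complex.Im z) = z + t%:C * 'i.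
  by rewrite /F; case: z {rz rhoz F} => x y /=; rewrite addrC; simpc.
split.
  have := @slice_derive1 _ F _ _ _ _ ReD (@normc_ge_absRe R) ReZ Fz normc_i rz rhoz.
  by rewrite /= subr0.
by have := @slice_derive1 _ F _ _ _ _ ImD (@normc_ge_absIm R) ImZ Fz normc_i rz rhoz.
Qed.

Let partial_le z : r < N z ->
  [/\ `|complex.Re (partial_x psi z) - 1| <= 10^-1,
      `|complex.Im (partial_x psi z)| <= 10^-1,
      `|complex.Re (partial_y psi z)| <= 10^-1 &
      `|complex.Im (partial_y psi z) - 1| <= 10^-1].
Proof.
move=> rz; have rhoz : 0 < (10 : R) < N z by rewrite ltr0n (le_lt_trans r10).
by have [? ?] := near_id_partial_x rz rhoz; have [] := near_id_partial_y rz rhoz.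
Qed.

Let normc_partial_le z : r < N z ->
  N (partial_x psi z) <= 2 /\ N (partial_y psi z) <= 2.
Proof.
move=> /partial_le[]; rewrite !ler_distl => /andP[? ?] h2 h3 /andP[? ?].
have h1 : `|complex.Re (partial_x psi z)| <= 11 / 10 by rewrite ler_norml; lra.
have h4 : `|complex.Im (partial_y psi z)| <= 11 / 10 by rewrite ler_norml; lra.
by split; apply: le_trans (normc_le_absD _) _; move: h1 h2 h3 h4; lra.
Qed.

Let slices_abs_continuous a b c d : @cplx R @` closed_rect a b c d `<=` U ->
  (forall y, c <= y <= d -> abs_continuous_on a b (fun x => psi (x +i* y))) /\
  (forall x, a <= x <= b -> abs_continuous_on c d (fun y => psi (x +i* y))).
Proof.
move=> sub.
have inU x y : a <= x <= b -> c <= y <= d -> r < N (x +i* y).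
  by move=> xab ycd; apply: sub; exists (x, y) => //; split; rewrite /= in_itv.
split=> [y ycd|x xab]; apply: (@lipschitz_abs_continuous _ _ _ 2) => // s t sa st tb.
  have tab : a <= t <= b by rewrite tb (le_trans sa).
  have sab : a <= s <= b by rewrite sa (le_trans st).
  apply: le_trans (psi_lip (inU t y tab ycd) (inU s y sab ycd)) _.
  have -> : (t +i* y) - (s +i* y) = (t - s)%:C by simpc.
  by rewrite normc_real ger0_norm ?subr_ge0.
have tcd : c <= t <= d by rewrite tb (le_trans sa).
have scd : c <= s <= d by rewrite sa (le_trans st).
apply: le_trans (psi_lip (inU x t xab tcd) (inU x s xab scd)) _.
have -> : (x +i* t) - (x +i* s) = (t - s)%:C * 'i by simpc.
by rewrite Normc.normcM normc_i mulr1 normc_real ger0_norm ?subr_ge0.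
Qed.

Let near_id_continuous : {in U, continuous (psi : C^o -> C^o)}.
Proof.
move=> z; rewrite inE /= => rz; apply/(@cvgrPdist_lt C C^o C^o (nbhs (z : C^o))) => eps eps0.
have epsE : eps = (complex.Re eps)%:C by rewrite RRe_real // gtr0_real.
have e0 : 0 < complex.Re eps by rewrite -ltcR -epsE.
apply/nbhs_ballP; exists (Num.min (N z - r) (complex.Re eps / 2))%:C => /=.
  by rewrite ltcR lt_min subr_gt0 rz divr_gt0.
move=> w; rewrite -ball_normE /= epsE !ltcR_norm lt_min => /andP[wr we].
have rw : r < N w.
  by have -> : w = z + (w - z) by [ring]; apply: stay_out; rewrite normc_distC.
by have := psi_lip rz rw; lra.
Qed.

(** The map is 2-Lipschitz along segments in [U], so every slice is absolutely continuous, and its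
    partial derivatives are bounded. *)
Lemma near_id_ACL2 : ACL2 U psi.
Proof.
split.
  split; first exact: near_id_continuous.
  move=> a b c d ab cd /slices_abs_continuous[Hx Hy].
  by split; apply: aeW.
move=> a b c d ab cd sub.
have mD : measurable (closed_rect a b c d) by exact: measurableX.
have fin : (area (closed_rect a b c d) < +oo)%E.
  rewrite /closed_rect product_measure1E //= !lebesgue_measure_itv /= !lte_fin ab cd.
  by rewrite -!EFinB -EFinM ltry.
have sq p : closed_rect a b c d p -> 0 <= N (partial_x psi (cplx p)) ^+ 2 <= 4 /\
    0 <= N (partial_y psi (cplx p)) ^+ 2 <= 4.
  move=> Dp; have rp : r < N (cplx p) by apply: sub; exists p.
  have -> : 4 = 2 ^+ 2 :> R by rewrite -natrX.
  have [px py] := normc_partial_le rp.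
  by rewrite !sqr_ge0 !lerXn2r ?nnegrE ?normc_ge0.
by split; apply: (@integral_bounded_lty _ _ _ _ _ _ 4) => // p /sq[].
Qed.

Lemma near_id_quasiregular : quasiregular U psi.
Proof.
split; first exact: near_id_ACL2.
(* |D psi|^2 <= 16, while the Jacobian is at least 81/100 - 1/100 = 4/5 = 16/20. *)
exists 20; first by rewrite ler1n.
apply: aeW => p Up v v1; have rp : r < N (cplx p) := Up.
have [px py] := normc_partial_le rp.
have Dv : N (differential psi (cplx p) v) <= 4.
  apply: le_trans (normc_triangle _ _) _; rewrite !Normc.normcM !normc_real.
  have := normc_ge_absRe v; have := normc_ge_absIm v; rewrite v1 => hi hr.
  have -> : 4 = 1 * 2 + 1 * 2 :> R by lra.
  by rewrite lerD // ler_pM ?normc_ge0.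
have : N (differential psi (cplx p) v) ^+ 2 <= 16.
  have -> : 16 = 4 ^+ 2 :> R by rewrite -natrX.
  by rewrite lerXn2r ?nnegrE ?normc_ge0.
move=> /le_trans; apply; rewrite /Defs.jacobian; have [] := partial_le rp.
move: (complex.Re (partial_x _ _)) (complex.Im (partial_x _ _)) => x1 x2.
move: (complex.Re (partial_y _ _)) (complex.Im (partial_y _ _)) => y1 y2.
rewrite !ler_norml => /andP[? ?] /andP[? ?] /andP[? ?] /andP[? ?].
have J1 : 81 / 100 <= x1 * y2 by nra.
have J2 : x2 * y1 <= 1 / 100 by nra.
by move: J1 J2; lra.
Qed.

(** At the identity the x-derivative is 1 and the y-derivative is i, so they cancel in the numerator
    up to 4 / rho, while the denominator stays at least 1; the two halves cancel. *)
Lemma near_id_dilatation z rho : r < N z -> 0 < rho < N z ->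
  N (dilatation psi z) <= 4 / rho.
Proof.
move=> rz rhoz; have [xr xi] := near_id_partial_x rz rhoz.
have [yr yi] := near_id_partial_y rz rhoz.
have [xr' _ _ yi'] := partial_le rz.
rewrite /dilatation /d_z /d_zbar.
move: (partial_x psi z) (partial_y psi z) xr xi yr yi xr' yi' => px py.
rewrite !ler_norml => /andP[? ?] /andP[? ?] /andP[? ?] /andP[? ?] /andP[? ?] /andP[? ?].
have Rei : complex.Re ('i * py) = - complex.Im py by case: (py) => ? ?; simpc.
have Imi : complex.Im ('i * py) = complex.Re py by case: (py) => ? ?; simpc.
have nbar : N (px + 'i * py) <= 4 * rho^-1.
  apply: le_trans (normc_le_absD _) _.
  have -> : 4 * rho^-1 = 2 * rho^-1 + 2 * rho^-1 by ring.
  by rewrite ReD ImD Rei Imi; apply: lerD; rewrite ler_norml; lra.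
have nz : 1 <= N (px - 'i * py).
  apply: le_trans (normc_ge_absRe _); apply: le_trans (ler_norm _).
  by rewrite ReB Rei; lra.
rewrite Normc.normcM Normc.normcV !Normc.normcM Normc.normcV normc_nat.
rewrite ler_pdivrMr; last by rewrite divr_gt0 // (lt_le_trans ltr01).
have : 4 * rho^-1 * 1 <= 4 * rho^-1 * N (px - 'i * py).
  by rewrite ler_wpM2l // mulr_ge0 // invr_ge0 ltW; case/andP: rhoz.
by move: nbar; lra.
Qed.

Lemma near_id_asymptotically_conformal : asymptotically_conformal U psi.
Proof.
(* With rho = 8 / eps the dilatation is at most eps / 2, which gives the strict inequality. *)
move=> eps eps0; exists [set z | Num.max r (8 / eps) < N z]; split.
- by split; [exact: open_normc_gt | exists (Num.max r (8 / eps))].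
- by move=> z /=; rewrite gt_max => /andP[].
apply: aeW => p Vp; have : Num.max r (8 / eps) < N (cplx p) := Vp.
rewrite gt_max => /andP[rp ep].
have e8 : 0 < 8 / eps < N (cplx p) by rewrite ep divr_gt0.
apply: le_lt_trans (near_id_dilatation rp e8) _.
have -> : 4 / (8 / eps) = eps / 2 by field; rewrite gt_eqF.
by lra.
Qed.

End NearIdentity.

(** * Choice of the constants and of the escape radius *)

Lemma escape_constants {R : realType} (a b e c : R[i]) :
  let N := @Normc.normc R in
  let H := N a + N b in let l := N a - N b in let S := N c + 1 + H ^+ 2 in
  0 < l -> exists r m B A : R,
  [/\ [/\ 10 <= r, 0 < m, 0 < B & 1 <= A],
      [/\ forall z, r < N z -> B <= N (affine_map a b e z),
          forall z, r < N z -> m * N z <= N (affine_map a b e z) &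
          forall z, r < N z -> A * N z <= N (affine_map a b e z ^+ 2 + c)],
      [/\ S <= 2 * l * B, 1 + 2 * H ^+ 2 <= l * B & 3 * H ^+ 2 <= l * B] &
      [/\ 3 * S * H <= 2 * m * l * B, 3 * H <= B & 12 * H <= l * A]].
Proof.
move=> N H l S l0.
have lH : l <= H by have := normc_ge0 b; rewrite /l /H /N; lra.
have H0 : 0 < H by exact: lt_le_trans lH.
have S0 : 0 <= S by rewrite !addr_ge0 ?normc_ge0 ?sqr_ge0.
have HH0 : 0 <= H ^+ 2 by exact: sqr_ge0.
have SH0 : 0 <= S * H / l by rewrite divr_ge0 ?mulr_ge0 // ltW.
have Hl0 : 0 < H * l by rewrite mulr_gt0.
(* One nonnegative summand for each lower bound demanded of [B]. *)
pose B := (S + (1 + 2 * H ^+ 2) + 3 * H ^+ 2) / l + 3 * S * H / l ^+ 2 + 3 * H.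
pose A := 12 * H / l.
(* Half of the smallest stretching is given up to absorb the translation [e]. *)
pose m := l / 2.
have m0 : 0 < m by rewrite divr_gt0.
have lB : l * B = S + (1 + 2 * H ^+ 2) + 3 * H ^+ 2 + 3 * (S * H / l) + 3 * (H * l).
  by rewrite /B; field; rewrite gt_eqF.
have A1 : 1 <= A by rewrite ler_pdivlMr // mul1r; lra.
have B3 : 3 * H <= B.
  have -> : B = l * B / l by field; rewrite gt_eqF.
  by rewrite ler_pdivlMr // lB; lra.
have B0 : 0 < B by lra.
(* The summands serve, in order, the near-identity estimates, |h z| >= m |z|, |h z| >= B, and |f z|
   >= m^2 |z|^2 - |c| >= A |z|. *)
pose r := 10 + N e / m + B / m + (A + N c) / m ^+ 2.
have r_e : 0 <= N e / m by rewrite divr_ge0 ?normc_ge0 // ltW.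
have r_B : 0 <= B / m by rewrite divr_ge0 // ltW.
have r_A : 0 <= (A + N c) / m ^+ 2.
  by rewrite divr_ge0 ?sqr_ge0 // addr_ge0 ?normc_ge0 // (le_trans ler01).
have r10 : 10 <= r by rewrite /r; lra.
have mr_e : N e <= m * r by rewrite mulrC -ler_pdivrMr // /r; lra.
have mr_B : B <= m * r by rewrite mulrC -ler_pdivrMr // /r; lra.
have mr_A : A + N c <= m ^+ 2 * r.
  by rewrite mulrC -ler_pdivrMr ?exprn_gt0 // /r; lra.
have h_ge z : r < N z -> m * N z <= N (affine_map a b e z).
  move=> rz; have := normc_sub_ge (rlin a b z) e; have := rlin_ge a b z.
  rewrite -/(affine_map a b e z) -/N -/l.
  have : m * r <= m * N z by rewrite ler_pM2l // ltW.
  have -> : l = 2 * m by rewrite /m; field.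
  by lra.
exists r, m, B, A; split; split => //.
- move=> z rz; apply: le_trans (h_ge z rz); apply: le_trans mr_B _.
  by rewrite ler_pM2l // ltW.
- move=> z rz; apply: le_trans (normc_sub_ge _ _); rewrite normcX -/N.
  have z1 : 1 <= N z by lra.
  have h2 : m ^+ 2 * N z ^+ 2 <= N (affine_map a b e z) ^+ 2.
    by rewrite -exprMn lerXn2r ?nnegrE ?normc_ge0 ?h_ge ?mulr_ge0 ?normc_ge0 // ltW.
  have z2 : (A + N c) * N z <= m ^+ 2 * N z ^+ 2.
    rewrite expr2 mulrA ler_wpM2r ?normc_ge0 //; apply: le_trans mr_A _.
    by rewrite ler_pM2l ?exprn_gt0 // ltW.
  have : N c * 1 <= N c * N z by rewrite ler_wpM2l ?normc_ge0.
  by lra.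
- by rewrite -mulrA lB; lra.
- by rewrite lB; lra.
- by rewrite lB; lra.
- have -> : 2 * m * l * B = l * (l * B) by rewrite /m; field.
  rewrite mulrC -ler_pdivrMl // lB.
  have -> : l^-1 * (H * (3 * S)) = 3 * (S * H / l) by ring.
  by lra.
- suff -> : l * A = 12 * H by [].
  by rewrite /A; field; rewrite gt_eqF.
Qed.

Unset Implicit Arguments.

Theorem theorem2p1 (R : realType) (a b e c : R[i]) (hab : `|b| < `|a|) :
  let h := affine_map a b e in
  let f := fun z : R[i] => h z ^+ 2 + c in
  exists (U : set R[i]) (psi : R[i] -> R[i]),
    [/\ nbhd_infty U,
        f @` U `<=` U,
        quasiconformal U psi,
        (forall z, U z -> h (psi z) ^+ 2 = psi (f z)) &
        asymptotically_conformal U psi].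
Proof.
move=> h f.
have nab : Normc.normc b < Normc.normc a by rewrite -ltcR.
have l0 : 0 < Normc.normc a - Normc.normc b by rewrite subr_gt0.
have [r [m [B [A [[r10 m0 B0 A1] [hB hm fA] [B1 B2 B3] [B4 B5 A2]]]]]] :=
  escape_constants e c l0.
have r1 : 1 <= r by apply: le_trans r10; rewrite ler1n.
have [eta [_ etaS etaE etaA]] :=
  conj_displacement nab r1 m0 B0 A1 hB hm fA B1 B2 B3 B4 B5 A2.
exists [set z | r < Normc.normc z], (fun z => z + eta z); split.
- by split; [exact: open_normc_gt | exists r].
- move=> _ [z /= rz <-]; apply: (lt_le_trans rz); apply: le_trans (fA z rz).
  by rewrite ler_peMl ?normc_ge0.
- split; first exact: near_id_quasiregular.
  exact: near_id_injective.
- by move=> z /= rz; exact: etaE.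
- exact: near_id_asymptotically_conformal.
Qed.
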